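(* Let $J:L_1(S)\rightrightarrows L_\infty(S)$ be the normalized duality mapping of the real Banach space $L_1(S)$. For $\theta^*=J(\theta)$, we have $$\widehat{D}^*J(\theta,\theta^* )(\theta^{**})=\{\theta^*\}.$$
   Context: $(S,\mathcal A,\mu)$ is a positive and complete measure space; it is a standing convention that the real Banach space $(L_1(S),\|\cdot\|_1)$ has dual space $L_1(S)^*=(L_\infty(S),\|\cdot\|_\infty)$ via $\langle k^*,f\rangle=\int_S k^*(s)f(s)\,\mu(ds)$, and that $L_1(S)$ and $L_\infty(S)$ are not reflexive. $\langle\cdot,\cdot\rangle_*$ is the pairing between $L_\infty(S)^*$ (identified in the paper with a space $ba(S,\mathcal A)$ of bounded finitely additive set functions acting by integration) and $L_\infty(S)$. $\theta,\theta^*,\theta^{**}$ are the origins of $L_1(S),L_\infty(S),L_\infty(S)^*$. The normalized duality mapping is $J(f)=\{f^*\in L_\infty(S):\langle f^*,f\rangle=\|f\|_1^2=\|f^*\|_\infty^2\}$; when $J(f)$ is a singleton it is identified with its unique element. For $f\in L_1(S)$, $f^*\in J(f)$, the Mordukhovich derivative of $J$ at $(f,f^* )$ is defined, for $\gamma\in L_\infty(S)^*$, by $$\widehat{D}^*J(f,f^* )(\gamma)=\left\{k^*\in L_\infty(S):\ \limsup_{(g,g^* )\to(f,f^* ),\ g\in L_1(S),\ g^*\in J(g)}\frac{\langle k^*,g-f\rangle-\langle\gamma,g^*-f^*\rangle_*}{\|g-f\|_1+\|g^*-f^*\|_\infty}\le0\right\},$$ with convergence in the norms and $(g,g^* )\ne(f,f^*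 )$. *)

(* Defs.v *)
From HB Require Import structures.
From mathcomp Require Import all_boot all_order all_algebra.
From mathcomp Require Import all_classical all_reals all_analysis.
From mathcomp Require Import ess_sup_inf measurable_realfun.

Set Implicit Arguments.
Unset Strict Implicit.
Unset Printing Implicit Defensive.
Import Order.TTheory GRing.Theory Num.Theory.
Import numFieldNormedType.Exports.
Local Open Scope classical_set_scope.
Local Open Scope ring_scope.

(* [LspaceType mu p1] has no algebraic structure in the library: it is made
   here into a normed space, with the operations of [LfunType mu p1] on
   representatives. *)
Section Lspace_normedModType.
Context d (T : measurableType d) (R : realType).
Variables (mu : {measure set T -> \bar R}) (p : \bar R) (p1 : (1 <= p)%E).
Local Notation Lp := (LspaceType mu p1).
Local Notation Lf := (LfunType mu p1).

Lemma Lnorm_ae_eq (f g : T -> R) : measurable_fun setT f ->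
  measurable_fun setT g -> f = g %[ae mu] ->
  'N[mu]_p[EFin \o f]%E = 'N[mu]_p[EFin \o g]%E.
Proof.
move=> mf mg fg; rewrite unlock /Lnorm.
case: p p1 => [r r1|_|//].
- congr (_ `^ _)%E; apply: ae_eq_integral => //.
  + apply: (@measurableT_comp _ _ _ _ _ _ (fun x => x `^ r)%E) => //=.
      exact: measurable_poweR.
    by apply: measurableT_comp => //; apply: measurableT_comp.
  + apply: (@measurableT_comp _ _ _ _ _ _ (fun x => x `^ r)%E) => //=.
      exact: measurable_poweR.
    by apply: measurableT_comp => //; apply: measurableT_comp.
  + by apply: filterS fg => x /[apply] /= ->.
- case: ifPn => // _; apply: eq_ess_sup.
  by apply: filterS fg => x /(_ I) /= ->.
Qed.

Lemma Lspace_finite_norm (u : Lp) : finite_norm mu p (u : T -> R).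
Proof. by case: u => u [[]]. Qed.

Lemma Lspace_measurable (u : Lp) : measurable_fun setT (u : T -> R).
Proof. exact: (@measurable_funPT _ _ _ _ (repr (LebesgueSpace.sort u))). Qed.

Lemma Lspace_Lfun (u : Lp) : (u : T -> R) \in Lfun mu p.
Proof.
rewrite inE; apply/andP; split; rewrite inE /=.
  exact: Lspace_measurable.
exact: Lspace_finite_norm.
Qed.

Definition Lspace_repr (u : Lp) : Lf := Lfun_Sub p1 (Lspace_Lfun u).

Section class.
Variable f : Lf.

Let mf : measurable_fun setT (f : T -> measurableTypeR R).
Proof. exact: (@measurable_funPT _ _ _ _ f). Qed.

Let f' : T -> measurableTypeR R := f.
#[local] HB.instance Definition _ := @isMeasurableFun.Build _ _ T (measurableTypeR R) f' mf.

Definition Lfun_aeclass : {mfun_ mu, T >-> measurableTypeR R} :=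
  \pi_({mfun_ mu, T >-> measurableTypeR R})%qT
    (f' : {mfun T >-> measurableTypeR R}).

Lemma Lfun_aeclassE : (Lfun_aeclass : T -> R) = f %[ae mu].
Proof.
have : (repr Lfun_aeclass = (f' : {mfun T >-> measurableTypeR R})
   %[mod {mfun_ mu, T >-> measurableTypeR R}])%qT by rewrite reprK.
by move=> /eqP; rewrite eqmodE => /asboolP.
Qed.

Lemma Lfun_aeclass_finite : finite_norm mu p (Lfun_aeclass : T -> R).
Proof.
have mc : measurable_fun setT (Lfun_aeclass : T -> R).
  exact: (@measurable_funPT _ _ _ _ (repr Lfun_aeclass)).
rewrite /finite_norm (Lnorm_ae_eq mc mf Lfun_aeclassE).
exact: Lfunction_finite.
Qed.

Definition Lspace_class : Lp :=
  LebesgueSpace.Pack (LebesgueSpace.Class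
    (isFinLebesgue.Axioms_ T R mu p p1 Lfun_aeclass Lfun_aeclass_finite)).

Lemma Lspace_classE : (Lspace_class : T -> R) = f %[ae mu].
Proof. exact: Lfun_aeclassE. Qed.

End class.

Lemma LspaceP (u v : Lp) : (u : T -> R) = v %[ae mu] -> u = v.
Proof.
case: u v => [u [[uP]]] [v [[vP]]] /= uv.
suff E : u = v by move: vP; rewrite -E => vP; rewrite (Prop_irrelevance uP vP).
rewrite -[u]reprK -[v]reprK; apply/eqP; rewrite eqmodE; exact/asboolP.
Qed.

HB.instance Definition _ := gen_eqMixin Lp.
HB.instance Definition _ := gen_choiceMixin Lp.

Definition Lspace_zero : Lp := Lspace_class 0.
Definition Lspace_opp (u : Lp) : Lp := Lspace_class (- Lspace_repr u).
Definition Lspace_add (u v : Lp) : Lp :=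
  Lspace_class (Lspace_repr u + Lspace_repr v).
Definition Lspace_scale (a : R) (u : Lp) : Lp :=
  Lspace_class (a *: Lspace_repr u).
Definition Lspace_norm (u : Lp) : R := fine 'N[mu]_p[EFin \o (u : T -> R)]%E.

Lemma Lspace0_ae : (Lspace_zero : T -> R) = cst 0 %[ae mu].
Proof. exact: Lspace_classE. Qed.
Lemma LspaceN_ae u : (Lspace_opp u : T -> R) = (fun x => - u x) %[ae mu].
Proof. exact: Lspace_classE. Qed.
Lemma LspaceD_ae u v :
  (Lspace_add u v : T -> R) = (fun x => u x + v x) %[ae mu].
Proof. exact: Lspace_classE. Qed.
Lemma LspaceZ_ae a u :
  (Lspace_scale a u : T -> R) = (fun x => a * u x) %[ae mu].
Proof. exact: Lspace_classE. Qed.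

Let addA : associative Lspace_add.
Proof.
move=> u v w; apply: LspaceP.
apply: filterS2
  (filterI (LspaceD_ae u (Lspace_add v w)) (LspaceD_ae v w))
  (filterI (LspaceD_ae (Lspace_add u v) w) (LspaceD_ae u v)).
by move=> x [/(_ I)-> /(_ I)->] [/(_ I)-> /(_ I)->] _; rewrite addrA.
Qed.
Let addC : commutative Lspace_add.
Proof.
move=> u v; apply: LspaceP.
apply: filterS2 (LspaceD_ae u v) (LspaceD_ae v u).
by move=> x /(_ I)-> /(_ I)-> _; rewrite addrC.
Qed.
Let add0 : left_id Lspace_zero Lspace_add.
Proof.
move=> u; apply: LspaceP.
apply: filterS2 (LspaceD_ae Lspace_zero u) Lspace0_ae.
by move=> x /(_ I)-> /(_ I)-> _; rewrite add0r.
Qed.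
Let addN : left_inverse Lspace_zero Lspace_opp Lspace_add.
Proof.
move=> u; apply: LspaceP.
apply: filterS3 (LspaceD_ae (Lspace_opp u) u) (LspaceN_ae u) Lspace0_ae.
by move=> x /(_ I)-> /(_ I)-> /(_ I)-> _; rewrite addNr.
Qed.
HB.instance Definition _ := GRing.isZmodule.Build Lp addA addC add0 addN.

Let scaleA a b u :
  Lspace_scale a (Lspace_scale b u) = Lspace_scale (a * b) u.
Proof.
apply: LspaceP.
apply: filterS3 (LspaceZ_ae a (Lspace_scale b u)) (LspaceZ_ae b u)
  (LspaceZ_ae (a * b) u).
by move=> x /(_ I)-> /(_ I)-> /(_ I)-> _; rewrite mulrA.
Qed.
Let scale1 : left_id 1 Lspace_scale.
Proof.
move=> u; apply: LspaceP; apply: filterS (LspaceZ_ae 1 u).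
by move=> x /(_ I)-> _; rewrite mul1r.
Qed.
Let scaleDr : right_distributive Lspace_scale +%R.
Proof.
move=> a u v; apply: LspaceP.
apply: filterS3 (filterI (LspaceZ_ae a (u + v)) (LspaceD_ae u v))
  (LspaceD_ae (Lspace_scale a u) (Lspace_scale a v))
  (filterI (LspaceZ_ae a u) (LspaceZ_ae a v)).
move=> x [/(_ I)-> /(_ I)->] /(_ I)-> [/(_ I)-> /(_ I)->] _.
by rewrite mulrDr.
Qed.
Let scaleDl u : {morph Lspace_scale^~ u : a b / a + b}.
Proof.
move=> a b; apply: LspaceP.
apply: filterS3 (LspaceZ_ae (a + b) u)
  (LspaceD_ae (Lspace_scale a u) (Lspace_scale b u))
  (filterI (LspaceZ_ae a u) (LspaceZ_ae b u)).
by move=> x /(_ I)-> /(_ I)-> [/(_ I)-> /(_ I)->] _; rewrite mulrDl.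
Qed.
HB.instance Definition _ :=
  GRing.Zmodule_isLmodule.Build R Lp scaleA scale1 scaleDr scaleDl.

Lemma Lspace_norm_class (f : Lf) :
  Lspace_norm (Lspace_class f) = fine 'N[mu]_p[EFin \o f]%E.
Proof.
congr fine; apply: Lnorm_ae_eq (Lspace_classE f) => //.
exact: Lspace_measurable.
Qed.

Let ler_normD (u v : Lp) :
  Lspace_norm (u + v) <= Lspace_norm u + Lspace_norm v.
Proof.
rewrite (Lspace_norm_class (Lspace_repr u + Lspace_repr v)).
exact: (ler_LnormD (Lspace_repr u) (Lspace_repr v)).
Qed.
Let normrZ (a : R) (u : Lp) : Lspace_norm (a *: u) = `|a| * Lspace_norm u.
Proof.
rewrite (Lspace_norm_class (a *: Lspace_repr u)).
apply/EFin_inj; rewrite EFinM.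
rewrite (finite_norm_fine (a *: Lspace_repr u)).
rewrite (finite_norm_fine (Lspace_repr u)).
exact: (LnormZ (Lspace_repr u) a).
Qed.
Let normr0_eq0 (u : Lp) : Lspace_norm u = 0 -> u = 0.
Proof.
move=> u0; apply: LspaceP.
apply: filterS2 (@fine_Lnormr_eq0 _ _ _ mu p p1 (Lspace_repr u) u0) Lspace0_ae.
by move=> x /(_ I) /= -> /(_ I) ->.
Qed.
HB.instance Definition _ :=
  Lmodule_isNormed.Build R Lp ler_normD normrZ normr0_eq0.

Lemma Lspace_normE (u : Lp) :
  `|u|%:E = 'N[mu]_p[EFin \o (u : T -> R)]%E.
Proof. exact: finite_norm_fine (Lspace_repr u). Qed.

End Lspace_normedModType.

Section dual.
Variables (R : realType) (V : normedModType R).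

Definition is_dual : {pred V -> R^o} :=
  mem [set f : V -> R^o | linear f /\ continuous f].

Record dual := Dual { dual_fun :> V -> R^o ; dualP : dual_fun \in is_dual }.

HB.instance Definition _ := [isSub for dual_fun].
HB.instance Definition _ := [Choice of dual by <:].

Lemma is_dual_submod_closed : submod_closed is_dual.
Proof.
split.
  rewrite inE; split=> [a u v|x]; last exact: cvg_cst.
  by rewrite scaler0 addr0.
move=> a f g; rewrite !inE => -[lf cf] [lg cg]; split.
  move=> b u v; rewrite !fctE lf lg !scalerDr !scalerA (mulrC a b).
  by rewrite addrACA.
by move=> x; apply: cvgD; [apply: cvgZr; exact: cf|exact: cg].
Qed.
HB.instance Definition _ :=
  GRing.isSubmodClosed.Build R (V -> R^o) is_dual is_dual_submod_closed.
HB.instance Definition _ := [SubChoice_isSubLmodule of dual by <:].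

Lemma dual_linear (f : dual) : linear f.
Proof. by have := dualP f; rewrite inE => -[]. Qed.

HB.instance Definition _ (f : dual) :=
  GRing.isLinear.Build R V R^o _ (dual_fun f) (dual_linear f).

Lemma dual_continuous (f : dual) : continuous f.
Proof. by have := dualP f; rewrite inE => -[]. Qed.

Definition dual_norm (f : dual) : R :=
  sup [set `|f x| | x in [set x : V | `|x| <= 1]].

Lemma dual_has_sup (f : dual) :
  has_sup [set `|f x| | x in [set x : V | `|x| <= 1]].
Proof.
split; first by exists `|f 0|, 0 => //=; rewrite normr0.
have /bounded_funP/(_ 1)[M fM] : bounded_near f (nbhs (0 : V)).
  exact/linear_bounded_continuous/dual_continuous.
by exists M => _ [x x1 <-]; exact: fM.
Qed.

Lemma dual_norm_ge (f : dual) x : `|f x| <= dual_norm f * `|x|.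
Proof.
have [->|x0] := eqVneq x 0.
  by rewrite raddf0 !normr0 mulr0.
have nx0 : 0 < `|x| by rewrite normr_gt0.
rewrite -ler_pdivrMr // mulrC -[_^-1]gtr0_norm ?invr_gt0 // -normrM -[_ * _]linearZ.
apply: ub_le_sup; first by have [] := dual_has_sup f.
exists (`|x|^-1 *: x) => //=.
by rewrite normrZ gtr0_norm ?invr_gt0 // mulVf // gt_eqF.
Qed.

Let dual_normD (f g : dual) : dual_norm (f + g) <= dual_norm f + dual_norm g.
Proof.
apply: ge_sup; first by have [] := dual_has_sup (f + g).
move=> _ [x /= x1 <-]; apply: (le_trans (ler_normD _ _)).
by apply: lerD; apply: ub_le_sup; (try by have [] := dual_has_sup f);
  (try by have [] := dual_has_sup g); exists x.
Qed.

Let dual_normZle (a : R) (f : dual) :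
  dual_norm (a *: f) <= `|a| * dual_norm f.
Proof.
apply: ge_sup; first by have [] := dual_has_sup (a *: f).
move=> _ [x /= x1 <-]; rewrite normrM ler_wpM2l //.
by apply: ub_le_sup; [have [] := dual_has_sup f|exists x].
Qed.

Let dual_normZ (a : R) (f : dual) : dual_norm (a *: f) = `|a| * dual_norm f.
Proof.
apply/eqP; rewrite eq_le dual_normZle /=.
have [->|a0] := eqVneq a 0.
  rewrite normr0 mul0r; apply: le_trans (normr_ge0 _) (ub_le_sup _ _).
    by have [_] := dual_has_sup (0 *: f); apply.
  by exists 0 => //=; rewrite normr0.
have na0 : 0 < `|a| by rewrite normr_gt0.
rewrite -ler_pdivlMl // -normfV.
by have := dual_normZle a^-1 (a *: f); rewrite scalerA mulVf // scale1r.
Qed.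

Let dual_norm0_eq0 (f : dual) : dual_norm f = 0 -> f = 0.
Proof.
move=> f0; apply/val_inj/funext => x; apply/eqP.
by rewrite -normr_le0; have := dual_norm_ge f x; rewrite f0 mul0r.
Qed.

HB.instance Definition _ :=
  Lmodule_isNormed.Build R dual dual_normD dual_normZ dual_norm0_eq0.

Lemma dual_normE (f : dual) :
  `|f| = sup [set `|f x| | x in [set x : V | `|x| <= 1]].
Proof. by []. Qed.

End dual.

(* Surjectivity of the canonical embedding into the bidual. *)
Definition reflexive_space (R : realType) (V : normedModType R) : Prop :=
  forall Phi : dual (dual V), exists v : V, forall phi : dual V, Phi phi = phi v.

Section duality_mapping.
Context d (S : measurableType d) (R : realType).
Variable mu : {measure set S -> \bar R}.

Definition L1 := LspaceType mu (lexx 1%E).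
Definition Linfty := LspaceType mu (leey 1%E).
HB.instance Definition _ := NormedModule.on L1.
HB.instance Definition _ := NormedModule.on Linfty.

Definition pairing (k : Linfty) (f : L1) : R := \int[mu]_s (k s * f s).

(* [k |-> pairing k] is an isometry of [Linfty] onto the dual of [L1]; this
   can fail for an arbitrary measure. *)
Definition Linfty_dual_of_L1 : Prop :=
  (forall k : Linfty, exists phi : dual L1,
     (forall f, phi f = pairing k f) /\ `|phi| = `|k|) /\
  (forall phi : dual L1, exists k : Linfty, forall f, phi f = pairing k f).

Definition duality_map (f : L1) : set Linfty :=
  [set k | pairing k f = `|f| ^+ 2 /\ `|f| ^+ 2 = `|k| ^+ 2].

(* The intended domain is [duality_map f fs]. The deleted neighbourhoods keep
   the denominator nonzero. *)
Definition Mordukhovich_derivative (f : L1) (fs : Linfty)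
    (gamma : dual Linfty) : set Linfty :=
  [set k | (limf_esup
    (fun g : L1 * Linfty =>
       ((pairing k (g.1 - f) - gamma (g.2 - fs)) /
        (`|g.1 - f| + `|g.2 - fs|))%:E)
    (within [set g | duality_map g.1 g.2] (f, fs)^') <= 0)%E].

End duality_mapping.

(* Main.v *)
Require Import Defs.
From HB Require Import structures.
From mathcomp Require Import all_boot all_order all_algebra.
From mathcomp Require Import all_classical all_reals all_analysis.
From mathcomp Require Import ess_sup_inf measurable_realfun.

Set Implicit Arguments.
Unset Strict Implicit.
Unset Printing Implicit Defensive.
Import Order.TTheory GRing.Theory Num.Theory.
Import numFieldNormedType.Exports.
Local Open Scope classical_set_scope.
Local Open Scope ring_scope.

(** At the origin the duality mapping is the singleton of 0 because the two
    norms agree on the graph of [duality_map].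

    For the derivative at [gamma = 0] the quotient reads
    [pairing k g / (|g| + |j|)], with [j] in [duality_map g]. If [k = 0] it
    vanishes identically. If [k] is nonzero, then [pairing k] is a nonzero
    functional, so that [pairing k f > 0] for some [f]
    ([exists_pairing_gt0]). Since [|j| = |g|] on the graph, the quotient is
    positively homogeneous of degree 0 in [g]: at every graph point above the ray
    [t *: f], [t > 0], it equals [pairing k f / (2 |f|)], a positive constant.
    Such points occur arbitrarily close to the origin
    ([within_dnbhs0_ray]), so the upper limit is positive.

    The analytic input is that every [f] has a dual element
    ([duality_map_nonempty]), namely [|f|] times the sign of [f]. The
    remaining facts about [pairing] come from the duality between [L1] and
    [Linfty]. *)

Section duality_map_of_L1.
Context d (S : measurableType d) (R : realType).
Variable mu : {measure set S -> \bar R}.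

Section signed_constant.
Variables (c : R) (f : L1 mu).
Hypothesis c0 : 0 <= c.

(** The sign of 0 is taken to be 1: the value at the zeros of [f] does not
    affect the product with [f], and so the modulus is [c] everywhere. *)
Definition signed_constant (s : S) : R := if f s < 0 then - c else c.

Lemma measurable_signed_constant : measurable_fun setT signed_constant.
Proof.
apply: measurable_fun_ifT => //.
by apply: measurable_fun_ltr => //; exact: Lspace_measurable.
Qed.

(** Only an upper bound is available here: the norm is 0 when [mu] is the zero
    measure. *)
Lemma Lnormy_signed_constant_le : ('N[mu]_+oo[EFin \o signed_constant] <= c%:E)%E.
Proof.
rewrite unlock; case: ifPn => _; last by rewrite lee_fin.
apply/ess_supP/nearW => s /=; rewrite lee_fin /signed_constant.
by case: ifPn => _; rewrite ?normrN ger0_norm.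
Qed.

Lemma signed_constant_Lfun : signed_constant \in Lfun mu +oo%E.
Proof.
rewrite inE; apply/andP; split; rewrite inE /=.
  exact: measurable_signed_constant.
exact: le_lt_trans Lnormy_signed_constant_le (ltry c).
Qed.

Definition signed_constant_class : Linfty mu :=
  Lspace_class (Lfun_Sub (leey 1%E) signed_constant_Lfun).

Lemma signed_constant_classE :
  (signed_constant_class : S -> R) = signed_constant %[ae mu].
Proof. exact: Lspace_classE. Qed.

Lemma norm_signed_constant_class_le : `|signed_constant_class| <= c.
Proof.
rewrite -lee_fin Lspace_normE; apply: le_trans Lnormy_signed_constant_le.
rewrite (Lnorm_ae_eq (leey 1%E) _ _ signed_constant_classE) //.
- exact: Lspace_measurable.
- exact: measurable_signed_constant.
Qed.

Lemma integral_norm_L1 : \int[mu]_s `|f s| = `|f|.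
Proof. by rewrite -[RHS]/(fine ('N[mu]_1[EFin \o f])%E) Lnorm1. Qed.

(** The sign of [f] turns [f] into [|f|] under the integral, so the pairing
    attains the Hoelder bound. *)
Lemma pairing_signed_constant : pairing signed_constant_class f = c * `|f|.
Proof.
have mf : measurable_fun setT (f : S -> R) by exact: Lspace_measurable.
have If : mu.-integrable setT (EFin \o (fun s => `|f s|)).
  exact/Lfun1_integrable/Lfun_norm/Lspace_Lfun.
rewrite -integral_norm_L1 -RintegralZl // /pairing /Rintegral; congr fine.
apply: ae_eq_integral => //=.
- apply/measurable_EFinP/measurable_funM => //.
  exact: (Lspace_measurable signed_constant_class).
- by apply/measurable_EFinP/measurable_funM => //; exact: measurableT_comp.
- apply: filterS signed_constant_classE => s /= /(_ I) -> _.
  rewrite /signed_constant; case: ltP => fs.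
  + by rewrite ltr0_norm // mulrN mulNr.
  + by rewrite ger0_norm.
Qed.

End signed_constant.

Hypothesis dual_L1 : Linfty_dual_of_L1 mu.

(** Hoelder's inequality, read off from the isometry of [Linfty] into the dual
    of [L1]. *)
Lemma pairing_le (k : Linfty mu) (f : L1 mu) : `|pairing k f| <= `|k| * `|f|.
Proof.
have [/(_ k)[phi [phiE <-]] _] := dual_L1.
by rewrite -phiE; exact: dual_norm_ge.
Qed.

Lemma pairingZr (k : Linfty mu) a (f : L1 mu) :
  pairing k (a *: f) = a * pairing k f.
Proof.
have [/(_ k)[phi [phiE _]] _] := dual_L1.
by rewrite -!phiE linearZ.
Qed.

Lemma pairing0r (k : Linfty mu) : pairing k 0 = 0.
Proof.
by apply/eqP; rewrite -normr_le0 (le_trans (pairing_le _ _)) // normr0 mulr0.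
Qed.

Lemma pairing0l (f : L1 mu) : pairing 0 f = 0.
Proof.
by apply/eqP; rewrite -normr_le0 (le_trans (pairing_le _ _)) // normr0 mul0r.
Qed.

(** The isometry into the dual of [L1] makes [pairing] nondegenerate on the
    left, and a functional that is nowhere positive is zero, by oddness. *)
Lemma exists_pairing_gt0 (k : Linfty mu) :
  k != 0 -> exists f : L1 mu, 0 < pairing k f.
Proof.
move=> k0; apply: contrapT => /forallNP kle0.
have [/(_ k)[phi [phiE phik]] _] := dual_L1.
have pk0 (f : L1 mu) : phi f = 0.
  apply/eqP; rewrite eq_le; have le0 g : phi g <= 0.
    by rewrite phiE leNgt; apply/negP/kle0.
  by rewrite le0 /= -oppr_le0 -raddfN le0.
suff phi0 : phi = 0 by move: k0; rewrite -normr_eq0 -phik phi0 normr0 eqxx.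
exact/val_inj/funext.
Qed.

(** The element is [|f|] times the sign of [f]. Its norm is at most [|f|] by
    construction, and at least [|f|] by Hoelder's inequality, because its
    pairing with [f] is [|f| ^+ 2]. *)
Lemma duality_map_nonempty (f : L1 mu) : duality_map f !=set0.
Proof.
pose j := signed_constant_class f (normr_ge0 f).
have jf : pairing j f = `|f| ^+ 2 by rewrite pairing_signed_constant.
exists j; split=> //; congr (_ ^+ 2); apply/eqP; rewrite eq_le.
rewrite norm_signed_constant_class_le andbT.
have [->|f0] := eqVneq f 0; first by rewrite normr0.
have nf0 : 0 < `|f| by rewrite normr_gt0.
rewrite -(ler_pM2r nf0) -expr2 -jf.
exact: le_trans (ler_norm _) (pairing_le _ _).
Qed.

Lemma duality_map0 : duality_map (0 : L1 mu) = [set (0 : Linfty mu)].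
Proof.
apply/seteqP; split=> [k [_]|_ ->] /=; last first.
  by split; rewrite ?pairing0l !normr0 ?expr0n.
move=> /esym/eqP; rewrite normr0 expr0n /= sqrf_eq0 normr_eq0.
by move=> /eqP.
Qed.

(** The duality mapping preserves norms, so the graph points above a ray
    tend to the origin in both components as the parameter tends to 0. *)
Lemma within_dnbhs0_ray (D : set (L1 mu * Linfty mu)) (f : L1 mu) :
  f != 0 -> (within [set g | duality_map g.1 g.2] ((0, 0)^')) D ->
  exists t : R, exists2 j : Linfty mu, 0 < t & `|j| = t * `|f| /\ D (t *: f, j).
Proof.
move=> f0 /nbhs_ballP[e /= e0 De].
have nf0 : 0 < `|f| by rewrite normr_gt0.
set t := e / 2 / `|f|.
have t0 : 0 < t by rewrite !divr_gt0.
have [j jP] := duality_map_nonempty (t *: f).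
have nt : `|t *: f| = e / 2.
  by rewrite normrZ gtr0_norm // divfK ?gt_eqF.
have nj : `|j| = e / 2.
  case: (jP) => _ /esym/eqP; rewrite nt eqrXn2 // => [/eqP//|].
  by rewrite divr_ge0 // ltW.
exists t, j => //; split; first by rewrite nj divfK // gt_eqF.
apply: De => //=.
- split => /=; rewrite -ball_normE /= sub0r normrN ?nt ?nj;
    by rewrite ltr_pdivrMr // ltr_pMr // ltr1n.
- apply/eqP => /(congr1 fst) /= tf0.
  by move/esym/eqP: nt; rewrite tf0 normr0 gt_eqF // divr_gt0.
Qed.

Lemma Mordukhovich_derivative0 :
  Mordukhovich_derivative (0 : L1 mu) (0 : Linfty mu) (0 : dual (Linfty mu)) =
    [set (0 : Linfty mu)].
Proof.
apply/seteqP; split=> [k /=|_ ->] /=; last first.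
  (* The quotient is identically 0, so the whole space serves as the
     neighbourhood that bounds the upper limit. *)
  apply: (@le_trans _ _ (ereal_sup ((fun g : L1 mu * Linfty mu =>
    ((pairing 0 (g.1 - 0) - (0 : dual (Linfty mu)) (g.2 - 0)) /
     (`|g.1 - 0| + `|g.2 - 0|))%:E) @` setT))).
    by apply: ereal_inf_lbound; exists setT => //; exact: filterT.
  apply: ge_ereal_sup => _ [g _ <-].
  by rewrite pairing0l subr0 mul0r.
apply: contraPP => /eqP /exists_pairing_gt0 [f kf].
have f0 : f != 0.
  by apply: contraTneq kf => ->; rewrite pairing0r ltxx.
have nf0 : 0 < `|f| by rewrite normr_gt0.
apply/negP; rewrite -ltNge.
(* The lower bound is the constant value of the quotient along the ray. *)
apply: (@lt_le_trans _ _ (pairing k f / (`|f| + `|f|))%:E).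
  by rewrite lte_fin divr_gt0 // addr_gt0.
apply: le_ereal_inf_tmp => _ [D /(within_dnbhs0_ray f0) [t [j t0 [nj Dj]]] <-].
apply: ereal_sup_ubound; exists (t *: f, j) => //=.
rewrite !subr0 pairingZr nj normrZ gtr0_norm // -mulrDr.
by rewrite -mulf_div divff ?gt_eqF // mul1r.
Qed.

End duality_map_of_L1.

Theorem theorem4p6 (R : realType) (d : measure_display) (S : measurableType d)
  (mu : {measure set S -> \bar R})
  (mu_complete : measure_is_complete mu)
  (dual_L1 : Linfty_dual_of_L1 mu)
  (L1_nonreflexive : ~ reflexive_space (L1 mu))
  (Linfty_nonreflexive : ~ reflexive_space (Linfty mu)) :
  duality_map (0 : L1 mu) = [set (0 : Linfty mu)] /\
  Mordukhovich_derivative (0 : L1 mu) (0 : Linfty mu) (0 : dual (Linfty mu)) =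
    [set (0 : Linfty mu)].
Proof. by split; [exact: duality_map0|exact: Mordukhovich_derivative0]. Qed.
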